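(* Let $n\ge 1$ and $1\le c\le n$. The map $\tau_{n,c}$, $(\pi,x)\mapsto \pi\cdot x$, is an action of $S_n$ on $\widehat{\mathrm{PF}}_{n,c}$ whose restriction to $S_{n-1}$ is isomorphic to $\rho_{n-1}$. Furthermore, the character $\chi_{n,c}$ of $\tau_{n,c}$ can be computed as follows. Let $\pi\in S_n$ have cycle type $\lambda=(\lambda_1,\dots,\lambda_\ell)$, and write $d=\gcd(\lambda_1,\dots,\lambda_\ell)$. Then $$\chi_{n,c}(\pi)=\begin{cases}\dfrac{d^2n^{\ell-2}}{2} & d \text{ even},\ \frac{n}{d}\text{ odd, and } d\mid 2c,\\[1ex] d^2n^{\ell-2} & d\text{ even},\ \frac nd\text{ even, and } d\mid c,\\ d^2n^{\ell-2} & d\text{ odd and } d\mid c,\\ 0&\text{otherwise.}\end{cases}$$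
   Context: $S_n$ is the group of permutations of $[n]=\{1,\dots,n\}$; $\pi_i$ denotes the image of $i$ under $\pi$; $S_{n-1}\subseteq S_n$ is the subgroup of permutations fixing $n$. $\mathbb{Z}_n$ is the set of integers modulo $n$, with representatives in $\{0,\dots,n-1\}$. An integer sequence $(x_1,\dots,x_m)$ is a parking function of length $m$ if its weakly increasing rearrangement $(z_1,\dots,z_m)$ satisfies $0\le z_i\le i-1$ for $i=1,\dots,m$. $\mathrm{PF}_m$ is the set of parking functions of length $m$ ($\mathrm{PF}_0$ consists of the empty sequence). Entries of elements of $\mathrm{PF}_{n-1}$ lie in $\{0,\dots,n-1\}$ and are viewed as elements of $\mathbb{Z}_n$. $\rho_{m}$ is the action of $S_m$ on $\mathrm{PF}_m$ (and the corresponding permutation representation) given by $\pi\cdot(x_1,\dots,x_m)=(x_{\pi_1},\dots,x_{\pi_m})$. For $1\le c\le n$ let $$\widehat{\mathrm{PF}}_{n,c}=\Big\{(x_1,\dots,x_n)\in\mathbb{Z}_n^n:\ (x_1,\dots,x_{n-1})\in\mathrm{PF}_{n-1},\ x_n\equiv c-\sum_{i=1}^{n-1}x_i \pmod n\Big\}.$$ Definition of $\tau_{n,c}$: for $\pi\in S_n$ and $(x_1,\dots,x_n)\in\widehat{\mathrm{PF}}_{n,c}$, by a theorem of Pollak there is exactly one $y\in\mathbb{Z}_n$ such that $(y+x_{\pi_1},\dots,y+x_{\pi_{n-1}})$ (addition modulo $n$) is in $\mathrm{PF}_{n-1}$; for this $y$ one has $(y+x_{\pi_1},\dots,y+x_{\pi_n})\in\widehat{\mathrm{PF}}_{n,c}$,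 and one sets $\pi\cdot(x_1,\dots,x_n)=(y+x_{\pi_1},\dots,y+x_{\pi_n})$. Products of permutations are read left to right (first $\pi$, then $\sigma$, in $\pi\sigma$), so that $\pi\cdot(x_1,\dots,x_m)=(x_{\pi_1},\dots,x_{\pi_m})$ is a left action. The character of a permutation action at $\pi$ is the number of elements fixed by $\pi$. *)

(* Defs.v *)
From HB Require Import structures.
From mathcomp Require Import all_boot all_order all_algebra all_fingroup.

Set Implicit Arguments.
Unset Strict Implicit.
Unset Printing Implicit Defensive.

Import GRing.Theory.

Local Open Scope ring_scope.

(* Throughout n = m.+1, so that n - 1 = m; positions are numbered from 0, so
   the last position (n in 1-based numbering) is [ord_max : 'I_m.+1].  The
   group Z_n is 'I_m.+1 with its canonical addition modulo m.+1, which, unlike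
   'Z_n, is also correct for n = 1. *)

(* Nonnegativity of the entries is built into [nat]; with 0-based indices the
   condition z_i <= i - 1 becomes z_i <= i. *)
Definition parking (s : seq nat) : bool :=
  all (fun i => nth 0%N (sort leq s) i <= i)%N (iota 0 (size s)).

(* Parking functions of length m have all entries < m (when m > 0), so nothing
   is lost by taking the entries in 'I_m.+1. *)
Definition PF (m : nat) : {set {ffun 'I_m -> 'I_m.+1}} :=
  [set x : {ffun _} | parking [seq val (x i) | i <- enum 'I_m]].

Definition front (m : nat) (T : Type) (x : {ffun 'I_m.+1 -> T}) :
  {ffun 'I_m -> T} := [ffun i => x (lift ord_max i)].

Definition hatPF (m c : nat) : {set {ffun 'I_m.+1 -> 'I_m.+1}} :=
  [set x : {ffun _} | (front x \in PF m)
           && (x ord_max == inZp c - \sum_(i < m) front x i)].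

(* With the product of 'S_k, where (s * t) i = t (s i), this is a left action. *)
Definition rho (k : nat) (T : Type) (s : 'S_k) (x : {ffun 'I_k -> T}) :
  {ffun 'I_k -> T} := [ffun i => x (s i)].

Definition shift (m k : nat) (y : 'I_m.+1) (x : {ffun 'I_k -> 'I_m.+1}) :
  {ffun 'I_k -> 'I_m.+1} := [ffun i => y + x i].

(* By Pollak's theorem exactly one y satisfies the condition, so neither the
   choice made by [pick] nor the default value matters. *)
Definition pollak_shift (m : nat) (x : {ffun 'I_m.+1 -> 'I_m.+1}) : 'I_m.+1 :=
  odflt 0 [pick y | shift y (front x) \in PF m].

(* [tau] does not depend on c; c only enters through the set acted upon. *)
Definition tau (m : nat) (s : 'S_m.+1) (x : {ffun 'I_m.+1 -> 'I_m.+1}) :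
  {ffun 'I_m.+1 -> 'I_m.+1} := shift (pollak_shift (rho s x)) (rho s x).

(* The library's [action] is a right action, hence this definition. *)
Definition left_action (gT : finGroupType) (T : finType) (S : {set T})
    (to : gT -> T -> T) : Prop :=
  [/\ forall a x, x \in S -> to a x \in S,
      forall x, x \in S -> to 1%g x = x
    & forall a b x, x \in S -> to (a * b)%g x = to a (to b x)].

Definition isomorphic_actions (gT : finGroupType) (T U : finType)
    (S : {set T}) (to : gT -> T -> T) (S' : {set U}) (to' : gT -> U -> U) :
    Prop :=
  exists f : T -> U,
    [/\ {in S &, injective f},
        f @: S = S'
      & forall a x, x \in S -> f (to a x) = to' a (f x)].

(* The subgroup of 'S_m.+1 fixing [ord_max] is identified with 'S_m. *)
Definition extend_perm (m : nat) (s : 'S_m) : 'S_m.+1 :=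
  lift_perm ord_max ord_max s.

Definition perm_character (gT : finGroupType) (T : finType) (S : {set T})
    (to : gT -> T -> T) (a : gT) : nat :=
  #|[set x in S | to a x == x]|.

Definition cycle_type (k : nat) (s : 'S_k) : seq nat :=
  sort geq [seq #|X| | X : {set 'I_k} <- enum (porbits s)].

Definition gcd_seq (l : seq nat) : nat := \big[gcdn/0%N]_(k <- l) k.

(* Main.v *)
Require Import Defs.
From HB Require Import structures.
From mathcomp Require Import all_boot all_order all_algebra all_fingroup.
From mathcomp Require Import zify ring.

Set Implicit Arguments.
Unset Strict Implicit.
Unset Printing Implicit Defensive.

Import Order.TTheory GRing.Theory Num.Theory.

Local Open Scope ring_scope.

(** Since translating all entries by [y] does not change a sum of [n] elements of
    Z_n, Pollak's theorem says that the elements of hatPF represent the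
    classes, modulo translation, of the tuples in Z_n^n with sum [c]; S_n acts on
    these classes.  Pollak's theorem itself: translating [x] by [- t] gives a
    parking function iff [t] is the first minimum over 0 <= t < n of
    #{i | x_i < t} - t.

    A class is fixed by [s] iff x_{s i} = x_i + y for some [y], so [n] times the
    character counts such pairs (x, y).  Along a cycle of length w the equation
    forces w y = 0 and determines [x] from one entry a_r, and the sum of the
    entries is w a_r + y w (w - 1) / 2.  So y = k n / d with 0 <= k < d, and
    [sum_r w_r a_r = e] has d n^(l-1) solutions if d | e and none otherwise. *)

(** * Pollak's theorem *)

(** Sorting puts the entries at most [j] first, so one of them sits in position [j] iff there are
    more than [j] of them. Counts are easier to follow under translation than sorted lists. *)
Lemma parkingE (s : seq nat) :
  parking s = all (fun j => j < count (fun x => x <= j)%N s)%N (iota 0 (size s)).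
Proof.
apply: eq_in_all => i; rewrite mem_iota add0n /= => lti.
have ss : sorted <=%O (sort leq s) by apply: sort_sorted leq_total s.
rewrite -(count_sort leq) -(size_sort leq) in lti *.
apply/idP/idP => [|lt]; last exact: (nth_count_le 0%N ss lt).
by apply: contraTT; rewrite -leqNgt -ltnNge => le; apply: nth_count_gt ss _; rewrite le.
Qed.

Lemma PFE (m : nat) (x : {ffun 'I_m -> 'I_m.+1}) :
  (x \in PF m) = [forall j : 'I_m, (j < #|[set i | x i <= j]|)%N].
Proof.
rewrite inE parkingE size_map size_enum_ord.
have cE (j : nat) :
  count (fun k => k <= j)%N [seq val (x i) | i <- enum 'I_m] = #|[set i | x i <= j]|%N.
  by rewrite count_map cardsE cardE size_filter enumT.
apply/allP/forallP => [H j|H j].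
  by rewrite -cE; apply: H; rewrite mem_iota ltn_ord.
by rewrite mem_iota /= => ltj; rewrite cE; apply: (H (Ordinal ltj)).
Qed.

Definition count_below (m k : nat) (x : {ffun 'I_k -> 'I_m.+1}) (t : nat) : nat :=
  (\sum_i (x i < t))%N.

Lemma val_ordD (m : nat) (y z : 'I_m.+1) :
  nat_of_ord (y + z) = (if y + z < m.+1 then y + z else y + z - m.+1)%N.
Proof.
have lty := ltn_ord y; have ltz := ltn_ord z.
rewrite [LHS]/=; have [lt|le] := ltnP (y + z) m.+1; first by rewrite modn_small.
by rewrite -[in LHS](subnK le) modnDr modn_small //; lia.
Qed.

(** With [t] the representative of [- y], [y + x i < j] says that [x i] lies in the cyclic interval
    of length [j] starting at [t]; in the second case this interval reaches [m.+1] and wraps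
    around. *)
Lemma count_below_shift (m k : nat) (x : {ffun 'I_k -> 'I_m.+1}) (y : 'I_m.+1)
    (j : nat) : (j <= m.+1)%N ->
  (count_below (shift y x) j + count_below x (- y)%R =
   if - y + j < m.+1 then count_below x (- y + j)
   else k + count_below x (- y + j - m.+1))%N.
Proof.
move=> lej; rewrite /count_below.
have kE : k = (\sum_(i < k) 1)%N by rewrite sum1_card card_ord.
case: ifP => lt; rewrite ?[X in _ = (X + _)%N]kE -!big_split; apply: eq_bigr => i _;
  rewrite ffunE; have := val_ordD (y + x i) (- y); rewrite addrAC subrr add0r;
  have := ltn_ord (x i); have := ltn_ord (- y);
  have := ltn_ord (y + x i);
  move: (nat_of_ord (y + x i)) (nat_of_ord (x i)) (nat_of_ord (- y)) lt => a b t lt;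
  case: ifP => * /=; lia.
Qed.

(** The parking condition at [j] compares [count_below x u - u] at [t = - y] and at [u = t + j + 1]
    modulo [m.+1]. Once around there are [m] entries on [m.+1] places, so wrapping costs 1: hence
    the strict inequality for [u < t]. *)
Lemma PF_shift (m : nat) (x : {ffun 'I_m -> 'I_m.+1}) (y : 'I_m.+1) :
  reflect
    (forall u : nat, (u < m.+1)%N ->
       (count_below x (- y)%R + (m.+1 - (- y)%R) + (u < (- y)%R) <=
        count_below x u + (m.+1 - u))%N)
    (shift y x \in PF m).
Proof.
have cE (j : nat) : #|[set i | shift y x i <= j]|%N = count_below (shift y x) j.+1.
  by rewrite -sum1_card big_mkcond; apply: eq_bigr => i _; rewrite inE ltnS; case: leq.
rewrite PFE; set t := nat_of_ord (- y); have ltt : (t < m.+1)%N by apply: ltn_ord.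
apply: (iffP forallP) => [H u ltu|H j].
  have [ltut|ltut|->] := ltngtP u t; last lia.
    have ltj : ((m.+1 + u - t).-1 < m)%N by lia.
    have := H (Ordinal ltj); rewrite cE /=.
    have := @count_below_shift _ _ x y (m.+1 + u - t) _; rewrite -/t.
    have -> : (t + (m.+1 + u - t) - m.+1 = u)%N by lia.
    rewrite prednK; last lia. case: ifP; lia.
  have ltj : ((u - t).-1 < m)%N by lia.
  have := H (Ordinal ltj); rewrite cE /=.
  have := @count_below_shift _ _ x y (u - t) _; rewrite -/t.
  have -> : (t + (u - t) = u)%N by lia.
  rewrite ltu prednK; lia.
rewrite cE; have ltj := ltn_ord j.
have := @count_below_shift _ _ x y j.+1 _; rewrite -/t.
case: ifP => lt; last first.
  have := H (t + j.+1 - m.+1)%N; lia.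
have := H (t + j.+1)%N; lia.
Qed.

Lemma pollak_exists (m : nat) (x : {ffun 'I_m -> 'I_m.+1}) :
  exists y, shift y x \in PF m.
Proof.
pose f u := (count_below x u + (m.+1 - u))%N.
pose P t := (t <= m)%N && all (fun u => f t <= f u)%N (iota 0 m.+1).
have exP : exists t, P t.
  have [t _ tmin] := arg_minnP (fun u : 'I_m.+1 => f u) (erefl (xpredT ord0)).
  exists t; rewrite /P -ltnS ltn_ord; apply/allP => u; rewrite mem_iota => ltu.
  by apply: (tmin (Ordinal _)).
have [t /andP[let_ /allP fmin] tmin] := ex_minnP exP.
exists (- inord t); apply/PF_shift => u ltu.
rewrite opprK inordK //.
have := fmin u; rewrite mem_iota => /(_ ltu) le.
have [ltut|] /= := ltnP u t; last by rewrite addn0.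
(* [t] is the least minimum of [f], so an earlier [u] is not a minimum and [f u] exceeds [f t]. *)
have : ~~ P u by apply/negP => /tmin; lia.
rewrite /P (_ : (u <= m)%N) // andTb => /allPn[v]; rewrite mem_iota => ltv.
by have := fmin v; rewrite mem_iota => /(_ ltv); rewrite /f in le *; lia.
Qed.

(** Of two distinct first minima, the later one would have a strictly smaller value, which the
    earlier one excludes. *)
Lemma pollak_unique (m : nat) (x : {ffun 'I_m -> 'I_m.+1}) (y y' : 'I_m.+1) :
  shift y x \in PF m -> shift y' x \in PF m -> y = y'.
Proof.
move=> /PF_shift H /PF_shift H'; apply/oppr_inj/ord_inj.
have := H _ (ltn_ord (- y')); have := H' _ (ltn_ord (- y)).
move: (nat_of_ord (- y)) (nat_of_ord (- y')) => t t'; lia.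
Qed.

(** * The action *)

Lemma Zp_mulrn_modulus (m : nat) (y : 'I_m.+1) : y *+ m.+1 = 0.
Proof. by rewrite Zp_mulrn; apply/val_inj; rewrite /= modnMl. Qed.

Lemma shiftD (m k : nat) (y z : 'I_m.+1) (x : {ffun 'I_k -> 'I_m.+1}) :
  shift y (shift z x) = shift (y + z) x.
Proof. by apply/ffunP => i; rewrite !ffunE addrA. Qed.

Lemma shift0 (m k : nat) (x : {ffun 'I_k -> 'I_m.+1}) : shift 0 x = x.
Proof. by apply/ffunP => i; rewrite ffunE add0r. Qed.

Lemma sum_shift (m : nat) (y : 'I_m.+1) (x : {ffun 'I_m.+1 -> 'I_m.+1}) :
  \sum_i shift y x i = \sum_i x i.
Proof.
under eq_bigr do rewrite ffunE.
by rewrite big_split /= sumr_const card_ord Zp_mulrn_modulus add0r.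
Qed.

Lemma rhoM (k : nat) (T : Type) (s t : 'S_k) (x : {ffun 'I_k -> T}) :
  rho (s * t) x = rho s (rho t x).
Proof. by apply/ffunP => i; rewrite !ffunE permM. Qed.

Lemma rho1 (k : nat) (T : Type) (x : {ffun 'I_k -> T}) : rho 1 x = x.
Proof. by apply/ffunP => i; rewrite ffunE perm1. Qed.

Lemma rho_shift (m k : nat) (s : 'S_k) (y : 'I_m.+1) (x : {ffun 'I_k -> 'I_m.+1}) :
  rho s (shift y x) = shift y (rho s x).
Proof. by apply/ffunP => i; rewrite !ffunE. Qed.

Lemma sum_rho (k : nat) (V : zmodType) (s : 'S_k) (x : {ffun 'I_k -> V}) :
  \sum_i rho s x i = \sum_i x i.
Proof.
under eq_bigr do rewrite ffunE.
by rewrite [RHS](reindex_inj (@perm_inj _ s)).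
Qed.

Lemma front_shift (m : nat) (y : 'I_m.+1) (x : {ffun 'I_m.+1 -> 'I_m.+1}) :
  front (shift y x) = shift y (front x).
Proof. by apply/ffunP => i; rewrite !ffunE. Qed.

Lemma front_rho_extend (m : nat) (T : Type) (s : 'S_m) (x : {ffun 'I_m.+1 -> T}) :
  front (rho (extend_perm s) x) = rho s (front x).
Proof. by apply/ffunP => i; rewrite !ffunE lift_perm_lift. Qed.

Lemma sum_front (m : nat) (V : zmodType) (x : {ffun 'I_m.+1 -> V}) :
  \sum_i x i = \sum_i front x i + x ord_max.
Proof.
rewrite big_ord_recr; congr (_ + _); apply: eq_bigr => i _; rewrite ffunE.
by congr (x _); exact/val_inj/esym/lift_max.
Qed.

(** The condition on the last entry becomes one on the total sum, which [rho] and [shift] both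
    preserve. *)
Lemma hatPFE (m c : nat) (x : {ffun 'I_m.+1 -> 'I_m.+1}) :
  (x \in hatPF m c) = (front x \in PF m) && (\sum_i x i == inZp c).
Proof.
rewrite in_set sum_front; congr (_ && _).
by apply/eqP/eqP => [->|<-]; [rewrite addrC subrK | rewrite addrAC subrr add0r].
Qed.

Lemma pollak_shiftP (m : nat) (x : {ffun 'I_m.+1 -> 'I_m.+1}) :
  shift (pollak_shift x) (front x) \in PF m.
Proof.
rewrite /pollak_shift; case: pickP => [//|none].
by have [y] := pollak_exists (front x); rewrite none.
Qed.

(** By uniqueness, exhibiting a translate with parking front determines [tau s x] without computing
    [pollak_shift]. *)
Lemma tau_eq (m : nat) (s : 'S_m.+1) (x : {ffun 'I_m.+1 -> 'I_m.+1}) (y : 'I_m.+1) :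
  front (shift y (rho s x)) \in PF m -> tau s x = shift y (rho s x).
Proof.
rewrite front_shift => yPF.
by rewrite /tau (pollak_unique yPF (pollak_shiftP (rho s x))).
Qed.

Lemma tau_hatPF (m c : nat) (s : 'S_m.+1) (x : {ffun 'I_m.+1 -> 'I_m.+1}) :
  x \in hatPF m c -> tau s x \in hatPF m c.
Proof.
rewrite !hatPFE => /andP[_ sumx].
by rewrite front_shift pollak_shiftP sum_shift sum_rho.
Qed.

Lemma tau_left_action (m c : nat) : left_action (hatPF m c) (@tau m).
Proof.
split=> [s x|x|s t x].
- exact: tau_hatPF.
- rewrite hatPFE => /andP[xPF _].
  by rewrite (@tau_eq _ _ _ 0) rho1 shift0.
(* [tau s (tau t x)] is a translate of [rho (s * t) x], and its front is parking because it lies in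
   [hatPF m c]. *)
- move=> xh; have := tau_hatPF s (tau_hatPF t xh).
  rewrite {1 3}/tau {1 3}/tau !rho_shift !shiftD -rhoM hatPFE => /andP[sPF _].
  exact: tau_eq.
Qed.

Lemma rho_PF (m : nat) (s : 'S_m) (x : {ffun 'I_m -> 'I_m.+1}) :
  x \in PF m -> rho s x \in PF m.
Proof.
rewrite !PFE => /forallP xPF; apply/forallP => j; rewrite (leq_trans (xPF j)) //.
rewrite -(card_imset _ (@perm_inj _ s^-1)); apply/subset_leq_card/subsetP => k /imsetP[i].
by rewrite inE => le ->; rewrite inE ffunE permKV.
Qed.

(** [front] is the isomorphism: the last entry is recovered from the sum, and a permutation fixing
    the last position keeps the front parking, so the translation is by 0. *)
Lemma tau_restriction (m c : nat) :
  isomorphic_actions (hatPF m c) (fun s : 'S_m => tau (extend_perm s))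
                     (PF m) (fun s : 'S_m => rho s).
Proof.
exists (@front m _); split.
- move=> x y; rewrite !hatPFE => /andP[_ /eqP sx] /andP[_ /eqP sy] eqf.
  have := sx; rewrite -sy !sum_front eqf => /addrI eql.
  apply/ffunP => i; case: (unliftP ord_max i) => [j|] -> //.
  by have /ffunP/(_ j) := eqf; rewrite !ffunE.
- apply/setP => z; apply/imsetP/idP => [[x]|zPF].
    by rewrite hatPFE => /andP[xPF _] ->.
  pose x := [ffun i => if unlift ord_max i is Some j then z j else inZp c - \sum_i z i].
  have fx : front x = z by apply/ffunP => i; rewrite !ffunE liftK.
  exists x => //; rewrite hatPFE sum_front fx zPF ffunE unlift_none.
  by rewrite addrC subrK eqxx.
- move=> s x; rewrite hatPFE => /andP[xPF _].
  rewrite (@tau_eq _ _ _ 0) shift0 front_rho_extend //; exact: rho_PF.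
Qed.

(** A translation class has [m.+1] tuples, exactly one of them with parking front. The increment
    equation is invariant under translation and holds for some [y] iff [tau s] fixes that
    representative. *)
Lemma card_tau_fixed (m c : nat) (s : 'S_m.+1) :
  (m.+1 * perm_character (hatPF m c) (@tau m) s =
   \sum_(y : 'I_m.+1) #|[set x : {ffun 'I_m.+1 -> 'I_m.+1} |
      ([forall i, x (s i) == x i + y] && (\sum_i x i == inZp c))%R]|)%N.
Proof.
have stepE (y : 'I_m.+1) (x : {ffun 'I_m.+1 -> 'I_m.+1}) :
    [forall i, x (s i) == x i + y] = (shift (- y) (rho s x) == x).
  apply/forallP/eqP => [H|/ffunP H i].
    by apply/ffunP => i; rewrite !ffunE (eqP (H i)) addrC addrK.
  by have := H i; rewrite !ffunE => <-; rewrite addrC addNKr.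
set A := [set x in hatPF m c | tau s x == x].
have AE x : (x \in A) = [&& front x \in PF m, \sum_i x i == inZp c & tau s x == x].
  by rewrite in_set hatPFE andbA.
have -> : (m.+1 * perm_character (hatPF m c) (@tau m) s)%N = #|setX [set: 'I_m.+1] A|.
  by rewrite cardsX cardsT card_ord.
(* For a fixed [x], the translation used by [tau s] is minus the increment of [x]; [f] pairs this
   increment with an arbitrary translate of [x]. *)
pose f (p : 'I_m.+1 * {ffun 'I_m.+1 -> 'I_m.+1}) :=
  (- pollak_shift (rho s p.2), shift p.1 p.2).
have f_inj : {in setX [set: 'I_m.+1] A &, injective f}.
  move=> [t x] [t' x']; rewrite !in_setX !AE => /and4P[_ xPF _ _].
  move=> /and4P[_ xPF' _ _] [_ eqx].
  have eqt : - t = - t'.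
    apply: (@pollak_unique _ (front (shift t x))).
      by rewrite front_shift shiftD addNr shift0.
    by rewrite eqx front_shift shiftD addNr shift0.
  have := congr1 (shift (- t)) eqx; rewrite {2}eqt !shiftD !addNr !shift0 => ->.
  by rewrite (oppr_inj eqt).
rewrite -(card_in_imset f_inj) -sum1_card.
under [RHS]eq_bigr do rewrite -sum1_card.
rewrite pair_big_dep /=; apply: eq_bigl => -[y z]; rewrite in_set stepE.
apply/imsetP/andP => [[[t x]]|[/eqP zstep sumz]].
  rewrite in_setX AE => /and4P[_ _ xsum /eqP xfix] [-> ->].
  rewrite opprK rho_shift shiftD addrC -shiftD -/(tau s x) xfix.
  by rewrite sum_shift.
(* The representative of the class of [z]; it has the same increment [y]. *)
set x := shift (pollak_shift z) z.
have xPF : front x \in PF m by rewrite front_shift pollak_shiftP.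
have xstep : shift (- y) (rho s x) = x.
  by rewrite rho_shift shiftD addrC -shiftD zstep.
have xfix : tau s x = x by rewrite (@tau_eq _ _ _ (- y)) xstep.
exists (- pollak_shift z, x).
  by rewrite in_setX AE inE xPF sum_shift sumz xfix eqxx.
rewrite /f /= shiftD addNr shift0; congr (_, _); apply: oppr_inj; rewrite opprK.
apply: (pollak_unique _ (pollak_shiftP (rho s x))).
by rewrite -front_shift xstep.
Qed.

(** * Tuples with a constant increment along cycles *)

Section CycleUnrolling.

Variables (T : finType) (s : {perm T}) (V : finZmodType).

Let s_sym : connect_sym (frel s) := fconnect_sym (@perm_inj _ s).

(** The type [{r : T | froots s r}] has one element per cycle of [s] and serves to index the
    cycles. *)
Definition cycle_root (i : T) : {r : T | froots s r} :=
  exist _ (froot s i) (roots_root s_sym i).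

Definition cycle_index (i : T) : nat := findex s (froot s i) i.

Lemma iter_cycle_index (i : T) : iter (cycle_index i) s (froot s i) = i.
Proof. by rewrite iter_findex // s_sym connect_root. Qed.

Lemma cycle_root_iter (r : {r : T | froots s r}) (k : nat) :
  cycle_root (iter k s (val r)) = r.
Proof.
apply/val_inj; rewrite /= -[RHS](eqP (valP r)); apply/esym/(fingraph.rootP s_sym).
exact: fconnect_iter.
Qed.

Lemma big_cycles (R : Type) (idx : R) (op : Monoid.com_law idx) (F : T -> R) :
  \big[op/idx]_i F i =
  \big[op/idx]_(r : {r : T | froots s r})
    \big[op/idx]_(k < fingraph.order s (val r)) F (iter k s (val r)).
Proof.
rewrite (partition_big cycle_root predT) //=; apply: eq_bigr => r _.
rewrite -(big_mkord predT (fun k => F (iter k s (val r)))).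
rewrite -(big_map (fun k => iter k s (val r)) predT).
have -> : [seq iter k s (val r) | k <- index_iota 0 (fingraph.order s (val r))]
          = fingraph.orbit s (val r).
  apply: (@eq_from_nth _ (val r)) => [|k].
    by rewrite size_map size_iota subn0 size_orbit.
  rewrite size_map size_iota subn0 => ltk.
  by rewrite (nth_map 0%N) ?size_iota ?subn0 // nth_iota ?subn0 // nth_traject.
rewrite big_uniq ?orbit_uniq //; apply: eq_bigl => i.
rewrite -fconnect_orbit; apply/eqP/idP => [<-|/iter_findex <-].
  by rewrite /= s_sym connect_root.
exact: cycle_root_iter.
Qed.

Lemma cycle_index_iter (r : {r : T | froots s r}) (k : nat) :
  cycle_index (iter k s (val r)) = (k %% fingraph.order s (val r))%N.
Proof.
set o := fingraph.order s (val r).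
have o_gt0 : (0 < o)%N by apply: fingraph.order_gt0.
have /(congr1 val) /= root_r := cycle_root_iter r k.
rewrite /cycle_index {}root_r [k in LHS](divn_eq k o) addnC iterD.
have -> : iter (k %/ o * o) s (val r) = val r.
  elim: (k %/ o)%N => [//|q IH].
  by rewrite mulSn iterD IH iter_order //; apply: perm_inj.
by rewrite findex_iter // ltn_mod.
Qed.

(** Such a tuple amounts to its values [a r] at the roots. ['C(w, 2)] is 0 + 1 + ... + (w - 1), the
    multiple of [y] collected along a cycle of length [w]. *)
Lemma card_increment_set (y e : V) :
  #|[set x : {ffun T -> V} | [forall i, x (s i) == x i + y] && (\sum_i x i == e)]| =
  if [forall r : {r : T | froots s r}, y *+ fingraph.order s (val r) == 0] then
    #|[set a : {ffun {r : T | froots s r} -> V} |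
        \sum_r a r *+ fingraph.order s (val r)
        + y *+ (\sum_(r : {r : T | froots s r}) 'C(fingraph.order s (val r), 2)) == e]|
  else 0%N.
Proof.
have iterE (x : {ffun T -> V}) i k : (forall i, x (s i) = x i + y) ->
    x (iter k s i) = x i + y *+ k.
  move=> H; elim: k => [|k IH]; first by rewrite addr0.
  by rewrite iterS H IH mulrSr addrA.
have sumE (x : {ffun T -> V}) : (forall i, x (s i) = x i + y) ->
    \sum_i x i = \sum_(r : {r : T | froots s r}) x (val r) *+ fingraph.order s (val r)
      + y *+ (\sum_(r : {r : T | froots s r}) 'C(fingraph.order s (val r), 2)).
  move=> H; rewrite big_cycles -sumrMnr -big_split; apply: eq_bigr => r _ /=.
  under eq_bigr do rewrite iterE //.
  by rewrite big_split /= sumr_const card_ord -bin2_sum big_mkord sumrMnr.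
case: ifP => [/forallP y0|/negP noy]; last first.
  apply: eq_card0 => x; rewrite inE; apply/negP => /andP[/forallP H _].
  apply: noy; apply/forallP => r.
  have := @iterE x (val r) (fingraph.order s (val r)) (fun i => eqP (H i)).
  rewrite iter_order; last exact: perm_inj.
  by rewrite -[LHS]addr0 => /addrI <-.
pose unroll (a : {ffun {r : T | froots s r} -> V}) :=
  [ffun i => a (cycle_root i) + y *+ cycle_index i] : {ffun T -> V}.
have unroll_root a r : unroll a (val r) = a r.
  by rewrite ffunE (cycle_root_iter r 0) (cycle_index_iter r 0) mod0n addr0.
have unroll_step a i : unroll a (s i) = unroll a i + y.
  have -> : s i = iter (cycle_index i).+1 s (val (cycle_root i)).
    by rewrite iterS iter_cycle_index.
  set r := cycle_root i; rewrite !ffunE cycle_root_iter cycle_index_iter -addrA -mulrSr.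
  (* At the end of a cycle the index drops back to 0; the full turn lost contributes [y] times the
     length, which is 0. *)
  rewrite [in RHS](divn_eq (cycle_index i).+1 (fingraph.order s (val r))).
  by rewrite mulrnDr mulnC mulrnA (eqP (y0 r)) mul0rn add0r.
have unroll_inj : injective unroll.
  by move=> a b eqab; apply/ffunP => r; rewrite -!unroll_root eqab.
rewrite -(card_imset _ unroll_inj); apply: eq_card => x; rewrite inE.
apply/andP/imsetP => [[/forallP H sumx]|[a]].
  have {}H i : x (s i) = x i + y by apply/eqP.
  exists [ffun r => x (val r)].
    by rewrite inE -(eqP sumx) sumE //; under eq_bigr do rewrite ffunE.
  apply/ffunP => i; rewrite !ffunE /= -iterE // iter_cycle_index //.
rewrite inE => /eqP sa ->; split; first by apply/forallP => i; rewrite unroll_step.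
by rewrite sumE // -sa; under eq_bigr do rewrite unroll_root.
Qed.

End CycleUnrolling.

(** * Weighted sums in Z_n *)

(* The library has the Finite and the Zmodule structure of [{ffun T -> V}], but
   not their join. *)
HB.instance Definition _ (T : finType) (V : finZmodType) :=
  GRing.Zmodule.on {ffun T -> V}.

(** The nonempty fibres are translates of each other, hence equally large, and they partition
    [V]. *)
Lemma card_fiber (V W : finZmodType) (f : {additive V -> W}) (e : W) :
  (#|[set a | f a == e]| * #|f @: [set: V]| =
   if e \in f @: [set: V] then #|V| else 0)%N.
Proof.
case: ifPn => [/imsetP[a0 _ ->]|en]; last first.
  rewrite eq_card0 // => a; rewrite inE; apply: contraNF en => /eqP <-.
  exact: imset_f.
rewrite -cardsT -[RHS]sum1_card.
rewrite (partition_big_imset f) /= mulnC -sum_nat_const; apply: eq_bigr => _ /imsetP[b _ ->].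
rewrite sum1dep_card -(card_imset _ (addrI (b - a0))); apply: eq_card => a.
rewrite !inE; apply/imsetP/eqP => [[x]|eqa].
  by rewrite inE => /eqP eqx ->; rewrite raddfD raddfB /= eqx subrK.
exists (a - (b - a0)); last by rewrite addrC subrK.
by rewrite inE !raddfB /= eqa addNKr opprK.
Qed.

Lemma dvdn_inZp (m d k : nat) :
  (d %| m.+1 -> (d %| (inZp k : 'I_m.+1)) = (d %| k))%N.
Proof. by move=> dn; rewrite /dvdn /= modn_dvdm. Qed.

Lemma sum_multiples (m d : nat) (F : 'I_m.+1 -> nat) : (d %| m.+1)%N ->
  (\sum_(e : 'I_m.+1 | d %| e) F e = \sum_(k < m.+1 %/ d) F (inZp (k * d)))%N.
Proof.
move=> dn; have d_gt0 : (0 < d)%N by apply: dvdn_gt0 dn.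
have ltq (e : 'I_m.+1) : (e %/ d < m.+1 %/ d)%N.
  by rewrite ltn_divRL // (leq_ltn_trans (leq_divM _ _)).
have ltn (k : 'I_(m.+1 %/ d)) : (k * d < m.+1)%N by rewrite -ltn_divRL.
rewrite (reindex_onto (fun k : 'I_(m.+1 %/ d) => inZp (k * d) : 'I_m.+1)
                      (fun e => Ordinal (ltq e))) => [|e de].
  apply: eq_bigl => k; rewrite dvdn_inZp // dvdn_mull // andTb.
  by apply/eqP/val_inj; rewrite /= modn_small // mulnK.
by apply/val_inj; rewrite /= divnK // modn_small.
Qed.

Section WeightedSums.

Variables (m : nat) (T : finType) (w : T -> nat).

Let d := \big[gcdn/0%N]_r w r.

Definition weighted_sum (a : {ffun T -> 'I_m.+1}) : 'I_m.+1 := \sum_r a r *+ w r.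

Fact weighted_sum_is_additive : nmod_morphism weighted_sum.
Proof.
split=> [|a b]; rewrite /weighted_sum.
  by rewrite big1 // => r _; rewrite ffunE mul0rn.
by rewrite -big_split; apply: eq_bigr => r _; rewrite ffunE mulrnDl.
Qed.

HB.instance Definition _ :=
  GRing.isNmodMorphism.Build {ffun T -> 'I_m.+1} 'I_m.+1 weighted_sum
    weighted_sum_is_additive.

(** Each weight is a multiple of [d], and so is each weighted sum, as [d] divides the modulus.
    Conversely Bezout's identity makes [d], hence every multiple of it, a weighted sum. *)
Lemma weighted_sum_image : (d %| m.+1)%N ->
  weighted_sum @: [set: {ffun T -> 'I_m.+1}] = [set e : 'I_m.+1 | d %| e]%N.
Proof.
move=> dn; apply/setP => e; rewrite inE; apply/imsetP/idP => [[a _ ->]|/dvdnP[k ek]].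
  apply: (big_ind (fun e : 'I_m.+1 => d %| e)%N) => [|x y dx dy|r _].
  - exact: dvdn0.
  - by rewrite /= /dvdn modn_dvdm // -/(dvdn _ _) dvdn_add.
  - rewrite Zp_mulrn dvdn_inZp // dvdn_mull //.
    by have /dvdn_biggcdP := dvdnn d; apply.
suff [a da] : exists a, weighted_sum a = inZp d.
  exists (a *+ k); rewrite ?inE // raddfMn /= da Zp_mulrn.
  by apply/val_inj; rewrite /= modnMml mulnC -ek modn_small.
rewrite /d; apply: (big_ind (fun x => exists a, weighted_sum a = inZp x)).
- by exists 0; rewrite raddf0; apply/val_inj; rewrite /= mod0n.
- move=> x y [a ax] [b bx].
  have [->|x_gt0] := posnP x; first by exists b; rewrite gcd0n.
  (* The coefficients satisfy [u * x = v * y + gcdn x y]. *)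
  case: (egcdnP y x_gt0) => u v uv _; exists (a *+ u - b *+ v).
  rewrite raddfB !raddfMn /= ax bx; apply/eqP; rewrite mulNrn subr_eq; apply/eqP/val_inj.
  by rewrite !Zp_mulrn /= !modnMml modnDm mulnC uv addnC mulnC.
- move=> r _; exists [ffun r' => if r' == r then inZp 1 else 0].
  rewrite /weighted_sum (bigD1 r) //= big1 => [|r' /negbTE nr]; last first.
    by rewrite ffunE nr mul0rn.
  by rewrite addr0 ffunE eqxx Zp_mulrn; apply/val_inj; rewrite /= modnMml mul1n.
Qed.

Lemma card_weighted_sum (e : 'I_m.+1) : (d %| m.+1)%N ->
  (#|[set a | weighted_sum a == e]| * (m.+1 %/ d) = (d %| e) * m.+1 ^ #|T|)%N.
Proof.
move=> dn; have := card_fiber weighted_sum e.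
have cardM : #|[set e : 'I_m.+1 | d %| e]%N| = (m.+1 %/ d)%N.
  by rewrite -sum1dep_card sum_multiples // sum1_card card_ord.
rewrite weighted_sum_image // cardM => ->.
by rewrite inE card_ffun card_ord; case: (d %| e)%N; rewrite ?mul1n ?mul0n.
Qed.

(** The gcd of the products [y * w r] is [y * d], so the conditions [m.+1 %| y * w r] merge into
    [m.+1 %| y * d]. *)
Lemma annihilates_weights (y : 'I_m.+1) : (d %| m.+1)%N ->
  [forall r, y *+ w r == 0] = (m.+1 %/ d %| y)%N.
Proof.
move=> dn; have mulE k : (y *+ k == 0) = (m.+1 %| y * k)%N.
  by rewrite Zp_mulrn -val_eqE.
have d_gt0 : (0 < d)%N by apply: dvdn_gt0 dn.
rewrite -(dvdn_pmul2r d_gt0) divnK // /d (big_morph (muln y) (muln_gcdr y) (muln0 y)).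
apply/forallP/dvdn_biggcdP => [H r _|H r]; first by rewrite -mulE.
by rewrite mulE H.
Qed.

End WeightedSums.

(** * The character *)

(** Source of the factor 1/2 in the character: half of the [k < d] have a prescribed parity. *)
Lemma card_odd_ord (g : nat) (b : bool) : (\sum_(k < g.*2) (odd k == b) = g)%N.
Proof.
elim: g b => [|g IH] b; first by rewrite big_ord0.
by rewrite doubleS !big_ord_recr /= IH odd_double; case: b; rewrite /= ?addn0 addn1.
Qed.

Lemma dvdn_bin2_odd (d k : nat) : odd d -> (d %| k -> d %| 'C(k, 2))%N.
Proof.
move=> od dk; have cop : coprime d 2 by rewrite coprimen2.
rewrite -(Gauss_dvdr _ cop) mul2n bin2 halfK.
have -> : odd (k * k.-1) = false by case: k {dk} => //= k; rewrite oddM /= andNb.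
by rewrite subn0 dvdn_mulr.
Qed.

(** For [k = 2a] the sum is a(2a - 1) + a = 2a * a, a multiple of [k]. *)
Lemma dvdn_bin2_even (d k : nat) : ~~ odd d -> (d %| k -> d %| 'C(k, 2) + k./2)%N.
Proof.
move=> ed /dvdnP[q ->]; set a := (q * d./2)%N.
have dvd2a : (d %| a.*2)%N by rewrite doubleMr even_halfK // dvdn_mull.
have -> : (q * d = a.*2)%N by rewrite doubleMr even_halfK.
rewrite bin2 -doubleMl !doubleK.
have [->|a_gt0] := posnP a; first by rewrite dvdn0.
by rewrite addnC -mulnS prednK ?double_gt0 // dvdn_mull.
Qed.

Section CharacterValue.

Variables (T : finType) (w : T -> nat).

Let d := \big[gcdn/0%N]_r w r.
Let n := (\sum_r w r)%N.
Let B := (\sum_r 'C(w r, 2))%N.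

Lemma gcd_dvd_weight r : (d %| w r)%N.
Proof. by have /dvdn_biggcdP := dvdnn d; apply. Qed.

Lemma gcd_dvd_total : (d %| n)%N.
Proof. by apply: dvdn_sum => r _; apply: gcd_dvd_weight. Qed.

(** For odd [d], [B] vanishes modulo [d]. For even [d = 2g], with [q = n %/ d], the condition is
    that [d] divides c + k g q^2. If [q] is even, the last term is a multiple of [d]; if [q] is odd,
    [g] must divide [c] and [k] must have the parity of c / g. *)
Lemma dvdn_shifted_total (c k : nat) : (0 < n)%N ->
  ((c == k * (n %/ d) * B %[mod d]) =
   if odd d then d %| c
   else if odd (n %/ d) then (d %| 2 * c) && (odd k == odd (2 * c %/ d)) else d %| c)%N.
Proof.
move=> n_gt0; set q := (n %/ d)%N.
have nE : n = (d * q)%N by rewrite mulnC divnK ?gcd_dvd_total.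
have d_gt0 : (0 < d)%N by apply: dvdn_gt0 gcd_dvd_total.
case: ifPn => [od|ed].
  have dB : (d %| B)%N by apply: dvdn_sum => r _; apply/dvdn_bin2_odd/gcd_dvd_weight.
  by rewrite /dvdn; have /eqP -> : (d %| k * q * B)%N by apply: dvdn_mull.
set g := d./2; have dE : d = (g * 2)%N by rewrite muln2 -[LHS]odd_double_half (negbTE ed).
have g_gt0 : (0 < g)%N by move: d_gt0; rewrite dE muln_gt0 => /andP[].
have halfn : (g * q = \sum_r (w r)./2)%N.
  apply: double_inj; rewrite -!muln2 mulnAC -dE -nE big_distrl; apply: eq_bigr => r _ /=.
  rewrite muln2 -[LHS]odd_double_half.
  by rewrite (negbTE (_ : ~~ odd (w r))) //; apply: contra ed => /(dvdn_odd (gcd_dvd_weight r)).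
(* With w_r = d u_r, C(w_r, 2) + w_r / 2 = w_r^2 / 2 is a multiple of d, so
   modulo d the sum B of the C(w_r, 2) is - n / 2 = - (d / 2) (n / d). *)
have dB : (d %| B + g * q)%N.
  rewrite halfn -big_split; apply: dvdn_sum => r _.
  by apply: (dvdn_bin2_even ed); apply: gcd_dvd_weight.
have -> : (c == k * q * B %[mod d])%N = (d %| c + k * q * (g * q))%N.
  rewrite -(eqn_modDr (k * q * (g * q))) -mulnDr.
  by rewrite /dvdn; have /eqP -> : (d %| k * q * (B + g * q))%N by apply: dvdn_mull.
case: ifPn => [oq|eq].
  have -> : (d %| 2 * c)%N = (g %| c)%N by rewrite dE mulnC dvdn_pmul2l.
  have [/dvdnP[c' ->]|ngc] := boolP (g %| c)%N; last first.
    apply: contraNF ngc => dc; rewrite -(@dvdn_addl (k * q * (g * q))).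
      by apply: dvdn_trans dc; rewrite dE dvdn_mulr.
    by rewrite dvdn_mull // dvdn_mulr.
  have -> : (2 * (c' * g) %/ d = c')%N by rewrite (_ : 2 * _ = d * c')%N ?mulKn // dE; lia.
  have -> : (c' * g + k * q * (g * q) = g * (c' + k * q * q))%N by lia.
  rewrite dE dvdn_pmul2l // dvdn2 oddD !oddM oq !andbT; by case: odd; case: odd.
by rewrite dvdn_addl // dvdn_mull // dE dvdn_pmul2l // dvdn2.
Qed.

(** The [k < d] that qualify are all, none or, when the parity of [k] is prescribed, half of them.
    Doubling avoids the fraction. *)
Lemma sum_dvdn_shifted_total (c : nat) : (0 < n)%N ->
  (2 * \sum_(k < d) (c == k * (n %/ d) * B %[mod d]) =
   if [&& ~~ odd d, odd (n %/ d) & d %| 2 * c] then d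
   else if [&& ~~ odd d, ~~ odd (n %/ d) & d %| c] || (odd d && (d %| c)) then d + d
   else 0)%N.
Proof.
move=> n_gt0; under eq_bigr do rewrite dvdn_shifted_total //.
have [od|ed] /= := boolP (odd d).
  by rewrite sum_nat_const card_ord; case: (d %| c)%N => /=; lia.
have [oq|eq] /= := boolP (odd (n %/ d)); last first.
  by rewrite sum_nat_const card_ord; case: (d %| c)%N => /=; lia.
case: (d %| 2 * c)%N => /=; last by rewrite big1_eq.
have := card_odd_ord d./2 (odd (2 * c %/ d)).
by rewrite even_halfK // => ->; rewrite mul2n even_halfK.
Qed.

End CharacterValue.

(** Each orbit counted by [cycle_type] contains exactly one root, and its size is the order of that
    root under iteration of [s]. *)
Lemma perm_cycle_type (k : nat) (s : 'S_k) :
  perm_eq (cycle_type s)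
    [seq fingraph.order s (val r) | r : {r : 'I_k | froots s r}].
Proof.
rewrite perm_sort.
have porbitE x y : (y \in porbit s x) = fconnect s x y.
  apply/porbitP/idP => [[i ->]|/iter_findex <-]; first by rewrite permX fconnect_iter.
  by exists (findex s x y); rewrite permX.
have -> : [seq fingraph.order s (val r) | r : {r : 'I_k | froots s r}] =
    [seq #|X| | X : {set 'I_k} <- [seq porbit s (val r) | r : {r : 'I_k | froots s r}]].
  by rewrite -map_comp; apply: eq_map => r /=; apply: eq_card => y; rewrite porbitE.
have s_sym := fconnect_sym (@perm_inj _ s).
apply/perm_map/uniq_perm => [||X]; first exact: enum_uniq.
  rewrite map_inj_uniq ?enum_uniq // => r r' /eqP.
  rewrite eq_porbit_mem porbitE => /(fingraph.rootP s_sym).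
  by rewrite (eqP (valP r)) (eqP (valP r')) => /val_inj.
rewrite mem_enum; apply/imsetP/mapP => [[x _ ->]|[r _ ->]]; last by exists (val r).
exists (cycle_root s x); first by rewrite mem_enum.
by apply/eqP; rewrite eq_porbit_mem porbitE /= s_sym connect_root.
Qed.

Lemma gcd_cycle_type (k : nat) (s : 'S_k) :
  gcd_seq (cycle_type s) =
  \big[gcdn/0%N]_(r : {r : 'I_k | froots s r}) fingraph.order s (val r).
Proof.
by rewrite /gcd_seq (perm_big _ (perm_cycle_type s)) big_map big_enum.
Qed.

Lemma size_cycle_type (k : nat) (s : 'S_k) :
  size (cycle_type s) = #|{: {r : 'I_k | froots s r}}|.
Proof. by rewrite (perm_size (perm_cycle_type s)) size_map -cardE. Qed.

Lemma sum_cycle_lengths (k : nat) (s : 'S_k) :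
  (\sum_(r : {r : 'I_k | froots s r}) fingraph.order s (val r) = k)%N.
Proof.
rewrite -[RHS]card_ord -sum1_card (big_cycles s).
by apply: eq_bigr => r _; rewrite sum1_card card_ord.
Qed.

Lemma dvdn_sub_inZp (m d a b : nat) :
  (d %| m.+1 -> (d %| (inZp a - inZp b : 'I_m.+1)%R) = (a == b %[mod d]))%N.
Proof.
move=> dn; set z := _ - _; have /(congr1 val) : z + inZp b = inZp a by rewrite subrK.
rewrite /= modnDmr => /(congr1 (modn^~ d)); rewrite !modn_dvdm // => <-.
by rewrite -[b in RHS]add0n eqn_modDr mod0n.
Qed.

(** On the left, [m.+1] comes from the translations and [m.+1 %/ d] from [card_weighted_sum]. The
    increments that close up along all cycles are [y = k * (m.+1 %/ d)] with [k < d]; the root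
    values then have weighted sum [c - y *+ B], which is possible iff [d] divides it. *)
Lemma tau_characterE (m c : nat) (s : 'S_m.+1) :
  let l := size (cycle_type s) in
  let d := gcd_seq (cycle_type s) in
  (m.+1 * (m.+1 %/ d) * perm_character (hatPF m c) (@tau m) s =
   (\sum_(k < d) (c == k * (m.+1 %/ d) *
       (\sum_(r : {r : 'I_m.+1 | froots s r}) 'C(fingraph.order s (val r), 2)) %[mod d]))
   * m.+1 ^ l)%N.
Proof.
rewrite size_cycle_type gcd_cycle_type.
set w := fun r : {r : 'I_m.+1 | froots s r} => fingraph.order s (val r).
move=> l d; rewrite -/l -/d.
set B := (\sum_(r : {r : 'I_m.+1 | froots s r}) 'C(fingraph.order s (val r), 2))%N.
have dn : (d %| m.+1)%N by rewrite -[m.+1](sum_cycle_lengths s); apply: gcd_dvd_total.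
have qd : (m.+1 %/ d %| m.+1)%N by apply: dvdn_div.
rewrite mulnAC card_tau_fixed.
under eq_bigr => y _ do rewrite card_increment_set annihilates_weights //.
rewrite -big_mkcond sum_multiples // (_ : m.+1 %/ (m.+1 %/ d) = d)%N; last first.
  by rewrite divnA // mulKn.
rewrite !big_distrl; apply: eq_bigr => k _ /=.
rewrite (_ : [set a | _] = [set a | weighted_sum w a == inZp c - inZp (k * (m.+1 %/ d)) *+ B]).
rewrite card_weighted_sum //; congr (_ * _)%N.
  rewrite Zp_mulrn dvdn_sub_inZp //= -(modnMml (_ %% _)) modn_dvdm //.
  by rewrite modnMml.
by apply/setP => a; rewrite !inE eq_sym -subr_eq eq_sym.
Qed.

Theorem theorem3p1 (m c : nat) (hc : (1 <= c <= m.+1)%N) :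
  [/\ left_action (hatPF m c) (@tau m),
      isomorphic_actions (hatPF m c) (fun s : 'S_m => tau (extend_perm s))
                         (PF m) (fun s : 'S_m => rho s)
    & forall s : 'S_m.+1,
        let l := size (cycle_type s) in
        let d := gcd_seq (cycle_type s) in
        (perm_character (hatPF m c) (@tau m) s)%:R =
          (if [&& ~~ odd d, odd (m.+1 %/ d) & d %| 2 * c]%N then
             d%:R ^+ 2 * m.+1%:R ^ (l%:Z - 2) / 2
           else if [&& ~~ odd d, ~~ odd (m.+1 %/ d) & d %| c]%N then
             d%:R ^+ 2 * m.+1%:R ^ (l%:Z - 2)
           else if (odd d && (d %| c))%N then
             d%:R ^+ 2 * m.+1%:R ^ (l%:Z - 2)
           else 0) :> rat].
Proof.
split; [exact: tau_left_action | exact: tau_restriction | move=> s l d].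
have total := sum_cycle_lengths s.
have dn : (d %| m.+1)%N.
  by rewrite /d gcd_cycle_type -[m.+1 in X in (_ %| X)%N]total; apply: gcd_dvd_total.
have := tau_characterE c s; rewrite -/l -/d /=.
set q := (m.+1 %/ d)%N; set K := (\sum_(k < d) _)%N; set fixed := perm_character _ _ _.
move=> /(congr1 (fun k : nat => k%:R : rat)); rewrite !natrM natrX => countE.
have KE : (2 * K = if [&& ~~ odd d, odd q & d %| 2 * c] then d
   else if [&& ~~ odd d, ~~ odd q & d %| c] || (odd d && (d %| c)) then d + d
   else 0)%N.
  rewrite /K /q /d gcd_cycle_type.
  have := sum_dvdn_shifted_total (w := fun r : {r : 'I_m.+1 | froots s r} =>
    fingraph.order s (val r)) c.
  by rewrite total; apply.
have nE : m.+1%:R = d%:R * q%:R :> rat by rewrite -natrM mulnC divnK.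
clearbody q K fixed d l.
have n_neq0 : m.+1%:R != 0 :> rat by rewrite pnatr_eq0.
have [d_neq0 q_neq0] : d%:R != 0 :> rat /\ q%:R != 0 :> rat.
  by move: n_neq0; rewrite nE mulf_eq0 negb_or => /andP.
(* As [q] is n / d, dividing K n^l by n q leaves K d n^(l - 2). The exponent is an integer since it
   is -1 for a single cycle. *)
have fixedE : fixed%:R = (2 * K)%:R * (d%:R * m.+1%:R ^ (l%:Z - 2) / 2) :> rat.
  apply: (mulfI (mulf_neq0 n_neq0 q_neq0)); rewrite countE expfzDr // natrM.
  have -> : m.+1%:R ^ (- 2) = m.+1%:R ^- 2 :> rat by [].
  have -> : m.+1%:R ^ l%:Z = m.+1%:R ^+ l :> rat by [].
  move: (m.+1%:R ^+ l) => N; rewrite nE; field.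
  by rewrite q_neq0.
rewrite fixedE KE; move: (m.+1%:R ^ (l%:Z - 2)) => N; case: ifP => _; first by field.
case: [&& _, _ & _] => /=; first by rewrite natrD; field.
by case: (_ && _) => /=; rewrite ?natrD; field.
Qed.
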